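(* Let $R$ be a finite commutative local ring with maximal ideal $I\unlhd R$, let $\varepsilon\in\{\pm 1\}\subset R$, and let $n>1$ be an integer such that $n$ is odd or $(-1)^{n/2}\ne\varepsilon$. If $\omega_n$ is the number of $\varepsilon$-quiddity cycles over $R/I$ of length $n$, then the number of $\varepsilon$-quiddity cycles over $R$ of length $n$ is $$\omega_n\cdot |I|^{n-3}.$$
   Context: For a commutative ring $S$ and $a\in S$ put $\eta(a):=\begin{pmatrix} a & -1\\ 1 & 0\end{pmatrix}$. For $\varepsilon\in S$, an $\varepsilon$-quiddity cycle of length $n$ over $S$ is a tuple $(c_1,\ldots,c_n)\in S^n$ with $\eta(c_1)\eta(c_2)\cdots\eta(c_n)=\varepsilon\,\mathrm{id}$, where $\mathrm{id}$ is the $2\times 2$ identity matrix. When $\varepsilon$-quiddity cycles over the field $R/I$ are considered for $\varepsilon\in R$, $\varepsilon$ is read as its image in $R/I$ under the canonical projection.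
   Formalization: For even n the condition (-1)^{n/2} ≠ ε is required in R/I rather than in R; read in R the claim is false, e.g. for R = Z/4, n = 4, ε = -1 there are 4 cycles over R while the formula gives 3·2 = 6. *)

(* Defs.v *)
From HB Require Import structures.
From mathcomp Require Export all_boot all_order all_algebra.

Set Implicit Arguments.
Unset Strict Implicit.
Unset Printing Implicit Defensive.

Import GRing.Theory.

Local Open Scope ring_scope.
Local Open Scope quotient_scope.

(* Elements of [idealr R] are proper ideals, so the whole ring is excluded. *)
Definition maximal_ideal (R : comNzRingType) (I : idealr R) : Prop :=
  forall J : idealr R, {subset I <= J} -> J =i I.

Definition local_ring_with (R : comNzRingType) (I : idealr R) : Prop :=
  maximal_ideal I /\ forall J : idealr R, maximal_ideal J -> J =i I.

(* [[Finite of _ by <:%/]] would give the quotient another equality test than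
   the one underlying its ring structure; [can_type] reuses the same one. *)
HB.instance Definition _ (R : finComNzRingType) (I : idealr R) :=
  Countable.copy {ideal_quot I} (can_type (@reprK _ {ideal_quot I})).
HB.instance Definition _ (R : finComNzRingType) (I : idealr R) :
    isFinite {ideal_quot I} :=
  CanIsFinite (@reprK _ {ideal_quot I}).

Definition eta (S : comNzRingType) (a : S) : 'M[S]_2 :=
  \matrix_(i < 2, j < 2) nth 0 (nth [::] [:: [:: a; -1];
                                             [:: 1;  0]] i) j.

Definition quiddity_cycle (S : comNzRingType) (eps : S) (n : nat)
    (c : n.-tuple S) : bool :=
  \prod_(a <- c) eta a == eps%:M.

Definition num_quiddity (S : finComNzRingType) (eps : S) (n : nat) : nat :=
  #|[set c : n.-tuple S | quiddity_cycle eps c]|.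

(* Main.v *)
From HB Require Import structures.
Require Import Defs.
From mathcomp Require Import ring.

(** Reduction modulo [I] sends quiddity cycles over [R] to quiddity cycles over
    [R / I], and every fibre of this map turns out to have [#|I| ^ (n - 3)]
    elements.

    The sign condition says that the zero tuple is not a cycle over [R / I]
    ([quiddity_neq0]), since [eta 0 ^+ 2 = -1]. So each cycle over [R / I] has
    a nonzero entry, and every lift of that entry to the local ring [R] is a
    unit ([local_unit]). As [eps] is scalar, the cycle condition is invariant
    under rotation ([quiddity_rot]), hence the nonzero entry may be assumed to
    be the second one of the cycle [x, u, y & s].

    Since [eps ^+ 2 = 1] and the matrices [eta a] have determinant 1, the cycle
    condition reads [eta x * eta u * eta y = M], where [M], of determinant 1,
    depends only on [s] ([quiddity_cons3]). The second row and column of the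
    product on the left are [(u * y - 1, - u)] and [(1 - x * u, - u)], so for
    [u] invertible the matrix [M] determines [u], then [x] and [y]; conversely
    the remaining entry of [M] is forced by its determinant, so that a matrix
    of determinant 1 with invertible lower right entry is always such a product
    ([eta3_inj], [eta3_of_det1]). Thus each of the [#|I| ^ (n - 3)] lifts of
    [s] to [R] extends in exactly one way to a cycle above the given one
    ([card_cycle_lifts_unit2]). Uniqueness over [R / I] guarantees that the
    three entries found over [R] do reduce to [x], [u], [y].

    For [n = 2] the exponent is negative, but a cycle of length 2 must be the
    zero tuple, which the sign condition excludes, so both counts vanish. *)

Set Implicit Arguments.
Unset Strict Implicit.
Unset Printing Implicit Defensive.

Import GRing.Theory.
Local Open Scope ring_scope.
Local Open Scope quotient_scope.

(** * Units of a finite local ring *)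

Section LocalRing.

Variable R : finComNzRingType.

(** Subsets of a finite ring form a finite type on which being a proper ideal
    is decidable, so an inclusion-maximal one exists without Zorn's lemma. *)
Lemma ideal_sub_maximal (J : idealr R) :
  exists2 M : idealr R, maximal_ideal M & {subset J <= M}.
Proof.
pose P (S : {set R}) := [&& 0 \in S, 1 \notin S &
  [forall a, forall u in S, forall v in S, a * u + v \in S]].
have PP (S : {set R}) : reflect (idealr_closed S) (P S).
  apply: (iffP and3P) => -[S0 S1 SD]; split=> //.
    by move=> a u v uS vS; move/forallP/(_ a)/forall_inP/(_ u uS): SD
      => /forall_inP; apply.
  apply/forallP=> a; apply/forall_inP=> u uS; apply/forall_inP=> v vS.
  exact: SD.
have Pideal (L : idealr R) : P [set x in L].
  apply/PP; split; rewrite ?inE ?idealr0 ?idealr1 // => a u v.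
  by rewrite !inE => uL vL; rewrite rpredD ?idealMr.
have [/= M /maxsetP[/PP PM Mmax] sJM] := maxset_exists (Pideal J).
pose MI := HB.pack_for (idealr R) (fun x => x \in M)
  (isIdealr.Build R (fun x => x \in M) PM).
exists MI => [L sML | x xJ]; last by apply: (subsetP sJM); rewrite inE.
have eLM : [set x in L] = M.
  by apply: Mmax => //; apply/subsetP=> x xM; rewrite inE; apply: sML.
by move=> x; rewrite -[RHS]/(x \in M) -eLM inE.
Qed.

(** The multiples of a nonunit form a proper ideal, which lies in some maximal
    ideal and therefore in [I]. *)
Lemma local_unit (I : idealr R) (u : R) :
  local_ring_with I -> u \notin I -> exists v, u * v = 1.
Proof.
move=> [_ Iuniq] uI.
have [/existsP[v /eqP uv]|nu] := boolP [exists v, u * v == 1]; first by exists v.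
have PJ : idealr_closed (fun x => [exists v, x == u * v]).
  split.
  - by apply/existsP; exists 0; rewrite mulr0.
  - by apply: contra nu => /existsP[v /eqP uv]; apply/existsP; exists v; rewrite uv.
  - move=> a _ _ /existsP[v /eqP->] /existsP[w /eqP->].
    by apply/existsP; exists (a * v + w); apply/eqP; ring.
pose J := HB.pack_for (idealr R) (fun x => [exists v, x == u * v])
  (isIdealr.Build R (fun x => [exists v, x == u * v]) PJ).
have [M Mmax sJM] := ideal_sub_maximal J.
case/negP: uI; rewrite -(Iuniq _ Mmax); apply: sJM.
by apply/existsP; exists 1; rewrite mulr1.
Qed.

End LocalRing.

(** * Products of the matrices eta *)

Section Eta.

Variable S : comNzRingType.
Implicit Types (x y u v : S) (s : seq S).

Lemma mx2P (A B : 'M[S]_2) :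
  A 0 0 = B 0 0 -> A 0 1 = B 0 1 -> A 1 0 = B 1 0 -> A 1 1 = B 1 1 -> A = B.
Proof.
move=> e00 e01 e10 e11; apply/matrixP => i j.
have ord2 (k : 'I_2) : k = 0 \/ k = 1.
  by case: k => [[|[|//]] ?]; [left | right]; apply: val_inj.
by case: (ord2 i) (ord2 j) => -> [] ->.
Qed.

Definition etaE := (mxE, big_ord_recl, big_ord0).

Lemma eta3E x u y (M : 'M[S]_2 := eta x * eta u * eta y) :
  [/\ M 0 0 = (x * u - 1) * y - x, M 0 1 = 1 - x * u,
      M 1 0 = u * y - 1 & M 1 1 = - u].
Proof. by rewrite /M /eta !etaE /=; split; ring. Qed.

(** The lower right entries give [u = u']; the off-diagonal ones are then affine
    in [x] and in [y], with the invertible coefficients [- u] and [u]. *)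
Lemma eta3_inj x u y x' u' y' v : u * v = 1 ->
  eta x * eta u * eta y = eta x' * eta u' * eta y' -> [/\ x = x', u = u' & y = y'].
Proof.
move=> uv; have [_ e01 e10 e11] := eta3E x u y.
move=> E; have [_] := eta3E x' u' y'.
rewrite -E e01 e10 e11 => ex ey /oppr_inj eu; subst u'.
split=> //.
  have xu : x * u = x' * u by move/addrI/oppr_inj: ex.
  by rewrite -[x]mulr1 -[x']mulr1 -uv !mulrA xu.
have uy : u * y = u * y' by move/addIr: ey.
by rewrite -[y]mul1r -[y']mul1r -uv !(mulrAC u v) uy.
Qed.

Lemma det_mx22 (A : 'M[S]_2) : \det A = A 0 0 * A 1 1 - A 0 1 * A 1 0.
Proof.
rewrite (expand_det_row _ 0) !big_ord_recl big_ord0 /cofactor !det_mx11 !mxE /=.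
rewrite !addn0 expr0 expr1.
have -> : lift 0 0 = 1 :> 'I_2 by apply: val_inj.
have -> : lift 1 0 = 0 :> 'I_2 by apply: val_inj.
by ring.
Qed.

(** The witnesses solve the three equations that [eta3_inj] relies on; the upper
    left entry then agrees because both sides have determinant 1. *)
Lemma eta3_of_det1 (M : 'M[S]_2) v : \det M = 1 -> - M 1 1 * v = 1 ->
  eta ((1 - M 0 1) * v) * eta (- M 1 1) * eta ((M 1 0 + 1) * v) = M.
Proof.
rewrite det_mx22 => detM dv.
have [e00 e01 e10 e11] :=
  eta3E ((1 - M 0 1) * v) (- M 1 1) ((M 1 0 + 1) * v).
apply: mx2P; rewrite ?e00 ?e01 ?e10 ?e11 ?opprK //.
(* The upper left entry, written modulo [- M 1 1 * v - 1] and [\det M - 1]. *)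
- transitivity (M 0 0 * (- M 1 1 * v)
      + (- M 1 1 * v - 1) * ((1 - M 0 1) * (M 1 0 + 1) * v)
      + (M 0 0 * M 1 1 - M 0 1 * M 1 0 - 1) * v).
    ring.
  by rewrite detM dv; ring.
- rewrite -mulrA [v * _]mulrC dv; ring.
- rewrite mulrCA dv; ring.
Qed.

Lemma det_eta x : \det (eta x) = 1.
Proof. by rewrite det_mx22 /eta !mxE /=; ring. Qed.

Lemma det_prod_eta s : \det (\prod_(a <- s) eta a) = 1.
Proof.
elim: s => [|a s IHs]; first by rewrite big_nil det1.
by rewrite big_cons -mulmxE det_mulmx det_eta mul1r.
Qed.

(** If [A * B] is scalar and [B] is invertible, then [B * A], being conjugate to
    [A * B], is the same scalar. *)
Lemma quiddity_rot (eps : S) k s :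
  (\prod_(a <- rot k s) eta a == eps%:M) = (\prod_(a <- s) eta a == eps%:M).
Proof.
have swap t1 t2 : \prod_(a <- t1 ++ t2) eta a = eps%:M ->
    \prod_(a <- t2 ++ t1) eta a = eps%:M.
  rewrite !big_cat /=; set A := \prod_(a <- t1) _; set B := \prod_(a <- t2) _.
  move=> AB; have BV : B *m \adj B = 1%:M by rewrite mul_mx_adj det_prod_eta.
  rewrite -mulmxE -[B *m A]mulmx1 -BV -[LHS]mulmxA [A *m _]mulmxA.
  rewrite [A *m B]AB mul_scalar_mx -scalemxAr BV.
  by rewrite scalemx1.
apply/eqP/eqP => [|E]; first rewrite -{2}(cat_take_drop k s); first exact: swap.
by apply: swap; rewrite cat_take_drop.
Qed.

(** The adjugate is the inverse here, all products of [eta]'s having determinant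
    1, and it makes sense over any commutative ring and commutes with ring
    morphisms. *)
Lemma quiddity_cons3 (eps : S) x u y s : eps ^+ 2 = 1 ->
  \prod_(a <- [:: x, u, y & s]) eta a = eps%:M <->
  eta x * eta u * eta y = eps *: \adj (\prod_(a <- s) eta a).
Proof.
move=> eps2; rewrite !big_cons !mulrA -mulmxE.
set P := \prod_(a <- s) _; have detP : \det P = 1 by apply: det_prod_eta.
split=> [E | ->]; last by rewrite -scalemxAl mul_adj_mx detP scalemx1.
have PV : P *m \adj P = 1%:M by rewrite mul_mx_adj detP.
by rewrite -[LHS]mulmx1 -PV mulmxA E mul_scalar_mx.
Qed.

Lemma prod_eta0 n :
  \prod_(a <- nseq n.*2 0) eta a = ((-1) ^+ n)%:M :> 'M[S]_2.
Proof.
elim: n => [|n IHn]; first by rewrite big_nil.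
rewrite doubleS /= !big_cons IHn exprS.
by apply: mx2P; rewrite !etaE /=; ring.
Qed.

(** For odd length the product of the matrices [eta 0] is [eta 0] up to sign,
    which is not even diagonal; for even length it is [(-1) ^+ n./2]. *)
Lemma quiddity_neq0 (eps : S) n s : size s = n ->
  odd n \/ (-1) ^+ n./2 <> eps -> \prod_(a <- s) eta a = eps%:M ->
  exists2 x, x \in s & x != 0.
Proof.
move=> sn eps_n cyc; apply/hasP; apply: contraT => /hasPn s0.
have {s0 sn} es : s = nseq n 0.
  by rewrite -sn; apply/all_pred1P/allP=> x /s0; rewrite negbK.
have := odd_double_half n; have [n_odd /= en|/negbTE n_even /= en] := boolP (odd n).
  move: cyc; rewrite es -en /= big_cons prod_eta0.
  move/matrixP/(_ 1 0)/eqP; rewrite !etaE /= mulr1n mul0r mul1r !addr0.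
  by rewrite signr_eq0.
case: eps_n => [|[]]; first by rewrite n_even.
move: cyc; rewrite es -en add0n doubleK prod_eta0.
by move/matrixP/(_ 0 0); rewrite !mxE.
Qed.

End Eta.

(** * Lifting cycles along a surjective morphism *)

(** The ideal enters only through the projection [f], of which two properties
    matter: it is onto, and the elements outside its kernel are units. *)

Section Lifting.

Variables (R S : finComNzRingType) (f : {rmorphism R -> S}).
Hypothesis f_local : forall u, f u != 0 -> exists v, u * v = 1.
Hypothesis f_surj : forall y, exists x, f x = y.

Local Notation K := #|[set x | f x == 0]|.

Lemma card_fiber y : #|[set x | f x == y]| = K.
Proof.
have [x0 fx0] := f_surj y.
rewrite -[RHS](card_imset _ (addrI x0)); apply: eq_card => x; rewrite inE.
apply/eqP/imsetP => [fx | [z]]; last first.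
  by rewrite inE => /eqP fz ->; rewrite rmorphD fz addr0.
by exists (x - x0); [rewrite inE rmorphB fx fx0 subrr | rewrite addrC subrK].
Qed.

Lemma card_lifts m (s : m.-tuple S) :
  #|[set t : m.-tuple R | map f t == s]| = (K ^ m)%N.
Proof.
pose F (i : 'I_m) := [set x | f x == tnth s i].
pose g (h : {ffun 'I_m -> R}) := [tuple h i | i < m].
have g_inj : injective g.
  move=> h h' E; apply/ffunP=> i.
  by rewrite -[LHS](tnth_mktuple h) -/(g h) E tnth_mktuple.
have <- : #|[set h in family F]| = (K ^ m)%N.
  rewrite cardsE card_family /image_mem (eq_map (g := fun=> K)); last first.
    by move=> i; apply: card_fiber.
  by rewrite foldrE big_map big_const_seq count_predT size_enum_ord iter_muln_1.
rewrite -(card_imset _ g_inj); apply: eq_card => t; rewrite inE.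
apply/eqP/imsetP => [ft | [h]].
  exists [ffun i => tnth t i]; last first.
    by apply: eq_from_tnth => i; rewrite tnth_mktuple ffunE.
  rewrite inE; apply/familyP => i; rewrite inE ffunE.
  have -> : s = [tuple of map f t] by apply: val_inj.
  by rewrite tnth_map.
rewrite inE => /familyP hF ->.
suff -> : s = [tuple of map f (g h)] by [].
apply: eq_from_tnth => i; rewrite tnth_map tnth_mktuple.
by have := hF i; rewrite inE => /eqP.
Qed.

Lemma map_prod_eta (s : seq R) :
  map_mx f (\prod_(a <- s) eta a) = \prod_(a <- map f s) eta a.
Proof.
elim: s => [|a s IHs]; first by rewrite !big_nil map_mx1.
rewrite /= !big_cons -mulmxE map_mxM IHs; congr (_ *m _).
by apply: mx2P; rewrite !mxE /= ?rmorphN ?rmorph1 ?rmorph0.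
Qed.

Lemma map_quiddity (eps : R) n (c : n.-tuple R) :
  quiddity_cycle eps c -> quiddity_cycle (f eps) [tuple of map f c].
Proof. by move=> /eqP cyc; apply/eqP; rewrite /= -map_prod_eta cyc map_scalar_mx. Qed.

(** The list [s] carries no size constraint so that it can be rotated and
    decomposed freely. *)
Definition cycle_lifts (eps : R) n (s : seq S) : {set n.-tuple R} :=
  [set c : n.-tuple R | quiddity_cycle eps c & map f c == s].

Lemma card_cycle_lifts_rot eps n k s :
  #|cycle_lifts eps n (rot k s)| = #|cycle_lifts eps n s|.
Proof.
have rot_inj_tuple : injective (fun c : n.-tuple R => [tuple of rot k c]).
  by move=> c c' /(congr1 val) /= /rot_inj /val_inj.
rewrite -(card_preimset _ rot_inj_tuple); apply: eq_card => c.
by rewrite !inE /quiddity_cycle quiddity_rot map_rot (inj_eq (@rot_inj _ _)).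
Qed.

(** Forgetting the first three entries is a bijection from the lifts of the
    cycle onto the lifts of [s]. It is injective because the lift of [u] is a
    unit. Surjectivity solves for the three missing entries over [R], and
    compares their images with [x], [u], [y] by uniqueness over [S]. *)
Lemma card_cycle_lifts_unit2 eps m (x u y : S) (s : m.-tuple S) :
  eps ^+ 2 = 1 -> u != 0 ->
  \prod_(a <- [:: x, u, y & s]) eta a = (f eps)%:M ->
  #|cycle_lifts eps m.+3 [:: x, u, y & s]| = (K ^ m)%N.
Proof.
move=> eps2 u0 cyc; rewrite -(card_lifts s).
pose tail3 (c : m.+3.-tuple R) : m.-tuple R := [tuple of behead (behead (behead c))].
pose core (t : seq R) := eps *: \adj (\prod_(a <- t) eta a).
rewrite -(card_in_imset (f := tail3)); last first.
  move=> c c'; case/tupleP: c => x1 c; case/tupleP: c => x2 c; case/tupleP: c => x3 c.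
  case/tupleP: c' => y1 c'; case/tupleP: c' => y2 c'; case/tupleP: c' => y3 c'.
  rewrite !inE /quiddity_cycle.
  case/andP=> /eqP /(quiddity_cons3 _ _ _ _ eps2) cyc1 /eqP [_ fx2 _ _].
  case/andP=> /eqP /(quiddity_cons3 _ _ _ _ eps2) cyc2 _ /(congr1 val) /= ecc.
  apply: val_inj => /=.
  have [v x2v] : exists v, x2 * v = 1 by apply: f_local; rewrite fx2.
  have E : eta x1 * eta x2 * eta x3 = eta y1 * eta y2 * eta y3.
    by rewrite cyc1 cyc2 ecc.
  by have [-> -> ->] := eta3_inj x2v E; rewrite ecc.
apply: eq_card => t; rewrite inE; apply/imsetP/eqP => [[c] | ft].
  rewrite inE => /andP[_ /eqP fc] ->; rewrite /= -!behead_map fc //.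
have feps2 : f eps ^+ 2 = 1 by rewrite -rmorphXn eps2 rmorph1.
have E : eta x * eta u * eta y = map_mx f (core t).
  move: cyc => /(quiddity_cons3 _ _ _ _ feps2) ->.
  by rewrite /core map_mxZ map_mx_adj map_prod_eta ft.
have fu : f (- core t 1 1) = u.
  have [_ _ _ e11] := eta3E x u y.
  have f11 (A : 'M[R]_2) : f (- A 1 1) = - map_mx f A 1 1 by rewrite mxE rmorphN.
  by rewrite f11 -E e11 opprK.
have [v uv] : exists v, - core t 1 1 * v = 1 by apply: f_local; rewrite fu.
have det_core : \det (core t) = 1.
  rewrite /core detZ eps2 mul1r -[LHS]mulr1 -[X in _ * X](det_prod_eta t).
  by rewrite -det_mulmx mul_adj_mx det_prod_eta det1.
have := eta3_of_det1 det_core uv.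
set x' := (_ * v); set y' := (_ * v) => E'.
exists [tuple of [:: x', - core t 1 1, y' & t]]; last exact: val_inj.
rewrite inE; apply/andP; split; first by apply/eqP/(quiddity_cons3 _ _ _ _ eps2).
have fuv : f (- core t 1 1) * f v = 1 by rewrite -rmorphM uv rmorph1.
have f_eta a : eta (f a) = map_mx f (eta a).
  by have := map_prod_eta [:: a]; rewrite /= !big_seq1 => ->.
have fE : eta (f x') * eta (f (- core t 1 1)) * eta (f y') = eta x * eta u * eta y.
  by rewrite E -[in RHS]E' !f_eta -!mulmxE !map_mxM.
have [<- _ <-] := eta3_inj fuv fE.
by rewrite /= ft fu.
Qed.

(** Rotating a nonzero entry into second position loses nothing, the number of
    lifts being rotation invariant. *)
Lemma card_cycle_lifts eps m (s : m.+3.-tuple S) :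
  eps ^+ 2 = 1 -> odd m.+3 \/ (-1) ^+ m.+3./2 <> f eps ->
  quiddity_cycle (f eps) s -> #|cycle_lifts eps m.+3 s| = (K ^ m)%N.
Proof.
move=> eps2 eps_n /eqP cyc.
have [u us u0] := quiddity_neq0 (size_tuple s) eps_n cyc.
have [i s' es] := rot_to us.
have : size s' = m.+2 by have := size_tuple s; rewrite -(size_rot i) es => -[].
case/lastP: s' es => // s' x es; rewrite size_rcons => -[].
case: s' es => // y t es [st].
(* One step backwards, [rotr 1], is spelled as a forward rotation so that the
   invariance under [rot] applies. *)
have {}es : rot (size (rot i s) - 1) (rot i s) = [:: x, u, y & Tuple (introT eqP st)].
  by rewrite -[LHS]/(rotr 1 _) es -rcons_cons rotr1_rcons.
move/eqP: cyc; rewrite -(card_cycle_lifts_rot _ _ i).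
rewrite -(card_cycle_lifts_rot _ _ (size (rot i s) - 1)).
rewrite -(quiddity_rot _ i) -(quiddity_rot _ (size (rot i s) - 1)) es => /eqP cyc.
exact: card_cycle_lifts_unit2.
Qed.

Lemma num_quiddity_lift eps m :
  eps ^+ 2 = 1 -> odd m.+3 \/ (-1) ^+ m.+3./2 <> f eps ->
  num_quiddity eps m.+3 = (num_quiddity (f eps) m.+3 * K ^ m)%N.
Proof.
move=> eps2 eps_n; rewrite /num_quiddity -sum1_card.
pose red (c : m.+3.-tuple R) : m.+3.-tuple S := [tuple of map f c].
rewrite (partition_big red (mem [set s | quiddity_cycle (f eps) s])) /=; last first.
  by move=> c; rewrite !inE; apply: map_quiddity.
rewrite -sum_nat_const; apply: eq_bigr => s; rewrite inE => s_cyc.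
rewrite -(card_cycle_lifts eps2 eps_n s_cyc) -sum1_card; apply: eq_bigl => c.
by rewrite !inE.
Qed.

End Lifting.

(* The non-equality of signs is required in R / I: required only in R, the claim
   fails, e.g. for R = Z/4, n = 4 and eps = -1 (4 cycles, whereas the formula
   gives 3 * 2). The two readings agree unless 2 lies in I and I is nonzero. *)
Theorem theorem1p1 (R : finComNzRingType) (I : idealr R) (eps : R) (n : nat)
    (hI : local_ring_with I) (heps : eps = 1 \/ eps = -1) (hn : (1 < n)%N)
    (hne : odd n \/ (-1) ^+ n./2 <> \pi_{ideal_quot I} eps) :
  (num_quiddity eps n)%:R =
    (num_quiddity (\pi_{ideal_quot I} eps) n)%:R *
      #|I|%:R ^ (n%:Z - 3) :> rat.
Proof.
have eps2 : eps ^+ 2 = 1 by case: heps => ->; rewrite ?sqrrN expr1n.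
pose f : {rmorphism R -> {ideal_quot I}} := \pi_{ideal_quot I}.
have f_eq0 x : (f x == 0) = (x \in I).
  by rewrite -(rmorph0 f) -Quotient.idealrBE subr0.
have f_local u : f u != 0 -> exists v, u * v = 1.
  by rewrite f_eq0; apply: local_unit.
have f_surj y : exists x, f x = y by exists (repr y); apply: reprK.
have cardI : #|[set x | f x == 0]| = #|I|.
  by apply: eq_card => x; rewrite inE f_eq0.
case: n hn hne => [|[|[|m]]] // _ hne; last first.
  rewrite (num_quiddity_lift f_local f_surj eps2 hne) natrM natrX cardI.
  by rewrite -[m.+3]addn3 PoszD addrK.
have no_cycle : num_quiddity (f eps) 2 = 0%N.
  apply: eq_card0 => c; case/tupleP: c => a c; case/tupleP: c => b c.
  rewrite inE; apply/negP => /eqP; rewrite tuple0 !big_cons big_nil mulr1.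
  case: hne => // hne /matrixP/(_ 1 1); rewrite !etaE /= => E; case: hne.
  rewrite expr1 -[RHS]mulr1n -[RHS]E; ring.
suff -> : num_quiddity eps 2 = 0%N by rewrite no_cycle mul0r.
apply: eq_card0 => c; rewrite inE; apply/negP => /(map_quiddity f) fc_cyc.
by have := card0_eq no_cycle [tuple of map f c]; rewrite inE fc_cyc.
Qed.
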